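(* Let $n\ge 1$, $d\ge 1$, and $\eta>0$. Consider the signed HJMR model: $n$ agents with opinions $\mathbf{X}_t^{(i)}\in\mathbb{S}^{d-1}$ updated by $\mathbf{X}_{t+1}^{(i)}=P_{\mathbb{S}^{d-1}}\big(\mathbf{X}_t^{(i)}+\eta\,\mathrm{sgn}(\langle\mathbf{X}_t^{(i)},\xi_t\rangle)\,\xi_t\big)$, $i=1,\ldots,n$, where $\xi_0,\xi_1,\ldots$ are i.i.d. from a distribution $\mathcal{D}$ on $\mathbb{S}^{d-1}$ for which there exist constants $C,C'>0$ with $C\mu(A)\le\Pr(\xi_t\in A)\le C'\mu(A)$ for every measurable $A\subseteq\mathbb{S}^{d-1}$, $\mu$ being the uniform (Haar) probability measure on $\mathbb{S}^{d-1}$. Then for every starting configuration $\mathbf{X}_0\in(\mathbb{S}^{d-1})^n$, almost surely $\rho(\mathbf{X}_t,P)\to 0$ (i.e., the system strongly polarizes).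
   Context: $\mathbb{S}^{d-1}$ is the unit sphere in $\mathbb{R}^d$, $P_{\mathbb{S}^{d-1}}(\mathbf{x})=\mathbf{x}/\|\mathbf{x}\|_2$, and $\mathrm{sgn}(0)=0$. The polarized set is $P=\{(\sigma_1\mathbf{x},\ldots,\sigma_n\mathbf{x}):\mathbf{x}\in\mathbb{S}^{d-1},\ \bm{\sigma}\in\{-1,1\}^n\}\subseteq(\mathbb{S}^{d-1})^n$, and $\rho(\mathbf{z},P)=\inf_{\mathbf{y}\in P}\|\mathbf{z}-\mathbf{y}\|_2$ (Euclidean distance in $(\mathbb{R}^d)^n$). *)

(* Defs.v *)
From HB Require Import structures.
From mathcomp Require Import all_boot all_order all_algebra.
From mathcomp Require Import all_classical all_reals all_analysis.

Set Implicit Arguments.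
Unset Strict Implicit.
Unset Printing Implicit Defensive.

Import Order.TTheory GRing.Theory Num.Theory.
Import numFieldNormedType.Exports.
Local Open Scope classical_set_scope.
Local Open Scope ring_scope.

Section Defs.
Variable R : realType.

(** R^d as row vectors, equipped with its Borel sigma-algebra (generated by
    the open sets of the usual (product = Euclidean) topology). *)
Definition Rd (d : nat) := g_sigma_algebraType (open : set_system 'rV[R]_d).

Definition dotv d (x y : 'rV[R]_d) : R := \sum_(j < d) x 0 j * y 0 j.
Definition norm2 d (x : 'rV[R]_d) : R := Num.sqrt (dotv x x).

Definition sphere d : set 'rV[R]_d := [set x | norm2 x = 1].

(** Projection onto the sphere, x / ||x||_2 (0 is sent to 0; irrelevant). *)
Definition proj_sphere d (x : 'rV[R]_d) : 'rV[R]_d := (norm2 x)^-1 *: x.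

(** One step of the signed HJMR dynamics for a single agent; Num.sg 0 = 0. *)
Definition hjmr_step d (eta : R) (x xi : 'rV[R]_d) : 'rV[R]_d :=
  proj_sphere (x + (eta * Num.sg (dotv x xi)) *: xi).

Fixpoint hjmr_traj n d (eta : R) (X0 : 'I_n -> 'rV[R]_d)
    (xis : nat -> 'rV[R]_d) (t : nat) : 'I_n -> 'rV[R]_d :=
  match t with
  | O => X0
  | S t' => fun i => hjmr_step eta (hjmr_traj eta X0 xis t' i) (xis t')
  end.

Definition distn n d (z y : 'I_n -> 'rV[R]_d) : R :=
  Num.sqrt (\sum_(i < n) dotv (z i - y i) (z i - y i)).

Definition polarized n d : set ('I_n -> 'rV[R]_d) :=
  [set y | exists x, @sphere d x /\
     exists sigma : 'I_n -> bool, y = fun i => (-1) ^+ sigma i *: x].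

Definition rho n d (z : 'I_n -> 'rV[R]_d) : R :=
  inf [set distn z y | y in @polarized n d].

Definition mutually_independent (dT : measure_display) (T : measurableType dT)
    d (P : probability T R) (xi : nat -> T -> Rd d) : Prop :=
  forall (s : seq nat) (A : nat -> set (Rd d)),
    uniq s -> (forall i, i \in s -> measurable (A i)) ->
    P (\big[setI/setT]_(i <- s) (xi i @^-1` A i)) =
    (\big[*%E/1%E]_(i <- s) P (xi i @^-1` A i))%E.

Definition uniform_sphere_measure d (mu : probability (Rd d) R) : Prop :=
  mu (~` @sphere d) = 0%E /\
  forall Q : 'M[R]_d, Q *m Q^T = 1%:M ->
    forall A : set (Rd d), measurable A ->
      mu ((fun x : Rd d => x *m Q) @^-1` A) = mu A.

End Defs.
Arguments sphere {R} d.
Arguments polarized {R} n d.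
Arguments Rd R d : clear implicits.

(* Main.v *)
Require Import Defs.
From HB Require Import structures.
From mathcomp Require Import all_boot all_order all_algebra.
From mathcomp Require Import all_classical all_reals all_analysis.
From mathcomp Require Import measurable_realfun ring lra.
Set Implicit Arguments.
Unset Strict Implicit.
Unset Printing Implicit Defensive.
Import Order.TTheory GRing.Theory Num.Theory.
Import numFieldNormedType.Exports.
Local Open Scope classical_set_scope.
Local Open Scope ring_scope.

(** It suffices to treat two agents [x] and [y], measuring their distance up to
    sign by [r = sqrt (1 - |<x, y>|)].  If [xi] lies on the same side of the
    hyperplanes orthogonal to [x] and [y] (after the sign change that makes
    [<x, y> >= 0]), both are translated by the same vector and [r] shrinks by the
    factor [g = 1 / sqrt (1 + eta ^ 2) < 1].  The exceptional set is a double
    wedge [W x y]; reflecting [x] through [y] produces a [z] at twice the angle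
    whose wedge [W x z] contains the disjoint sets [W x y] and [W y z] of equal
    measure, so [mu (W x y)] is at most [1/2] and is [O(r)].  Hence success has
    probability bounded below, and failure has probability [O(r)].  A bounded
    function [phi] of [r] then satisfies [E phi(r_{t+1}) <= E (phi(r_t) - r_t)], so
    [sum_t E r_t] is finite and [r_t] tends to [0] almost surely. *)

(** * Bilinear algebra of the inner product *)

Section dot_product.
Context {R : realType} {d : nat}.
Implicit Types (x y z : 'rV[R]_d) (a : R).

Lemma dotvC x y : dotv x y = dotv y x.
Proof. by apply: eq_bigr => j _; rewrite mulrC. Qed.

Lemma dotvDl x y z : dotv (x + y) z = dotv x z + dotv y z.
Proof. by rewrite -big_split; apply: eq_bigr => j _; rewrite mxE mulrDl. Qed.

Lemma dotvZl a x y : dotv (a *: x) y = a * dotv x y.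
Proof. by rewrite /dotv mulr_sumr; apply: eq_bigr => j _; rewrite mxE mulrA. Qed.

Lemma dotvNl x y : dotv (- x) y = - dotv x y.
Proof. by rewrite -scaleN1r dotvZl mulN1r. Qed.

Lemma dotvDr x y z : dotv x (y + z) = dotv x y + dotv x z.
Proof. by rewrite dotvC dotvDl !(dotvC x). Qed.

Lemma dotvZr a x y : dotv x (a *: y) = a * dotv x y.
Proof. by rewrite dotvC dotvZl dotvC. Qed.

Lemma dotvNr x y : dotv x (- y) = - dotv x y.
Proof. by rewrite dotvC dotvNl dotvC. Qed.

Definition dotvE := (dotvDl, dotvDr, dotvZl, dotvZr, dotvNl, dotvNr).

Lemma dotv_ge0 x : 0 <= dotv x x.
Proof. by apply: sumr_ge0 => j _; rewrite -expr2 sqr_ge0. Qed.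

Lemma dotv_eq0 x : (dotv x x == 0) = (x == 0).
Proof.
apply/eqP/eqP => [/eqP|->]; last first.
  by rewrite /dotv big1// => j _; rewrite mxE mul0r.
rewrite psumr_eq0 => [/allP x0|j _]; last by rewrite -expr2 sqr_ge0.
apply/rowP => j; have := x0 j (mem_index_enum _).
by rewrite -expr2 sqrf_eq0 mxE => /eqP.
Qed.

Lemma sphereP x : sphere d x <-> dotv x x = 1.
Proof.
rewrite /sphere/= /norm2; split=> [x1|->]; last by rewrite sqrtr1.
by rewrite -[LHS]sqr_sqrtr ?dotv_ge0// x1 expr1n.
Qed.

Lemma sphereN x : sphere d x -> sphere d (- x).
Proof. by move=> /sphereP x1; apply/sphereP; rewrite !dotvE opprK. Qed.

(** Cauchy-Schwarz for unit vectors, read off from [|x + y|^2 >= 0] and [|x - y|^2 >= 0]. *)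
Lemma dotv_sphere_le1 x y : sphere d x -> sphere d y -> `|dotv x y| <= 1.
Proof.
move=> /sphereP x1 /sphereP y1; rewrite ler_norml.
have := dotv_ge0 (x + y); have := dotv_ge0 (x - y).
by rewrite !dotvE x1 y1 (dotvC y x); lra.
Qed.

End dot_product.

(** * One step of the dynamics and its contraction of misalignment *)

Section step.
Context {R : realType} {d : nat} (eta : R).
Hypothesis eta0 : 0 < eta.
Implicit Types x y xi : 'rV[R]_d.

(** Oddness of the step allows the sign of one agent to be changed, hence the reduction to a
    nonnegative inner product. *)
Lemma hjmr_stepN x xi : hjmr_step eta (- x) xi = - hjmr_step eta x xi.
Proof.
rewrite /hjmr_step /proj_sphere dotvNl sgrN mulrN scaleNr -opprD.
by rewrite /norm2 dotvNl dotvNr opprK scalerN.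
Qed.

(** The added multiple of [xi] has inner product [eta * |<x, xi>| >= 0] with [x], so expanding the
    square adds only nonnegative terms to 1. Normalization therefore never divides by 0. *)
Lemma unnormalized_step_ge1 x xi : sphere d x ->
  1 <= dotv (x + (eta * Num.sg (dotv x xi)) *: xi)
            (x + (eta * Num.sg (dotv x xi)) *: xi).
Proof.
move=> /sphereP x1; rewrite !dotvE x1 (dotvC xi x).
have a0 : 0 <= Num.sg (dotv x xi) * dotv x xi by rewrite -normrEsg.
have := dotv_ge0 xi.
set s := Num.sg _ in a0 *.
move: s (dotv x xi) (dotv xi xi) a0 => s a b sa b0.
have e0 := ltW eta0; have := mulr_ge0 e0 sa.
by have := mulr_ge0 (sqr_ge0 (eta * s)) b0; lra.
Qed.

Lemma sphere_hjmr_step x xi : sphere d x -> sphere d (hjmr_step eta x xi).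
Proof.
move=> /(@unnormalized_step_ge1 _ xi); rewrite /hjmr_step /proj_sphere.
set z := x + _ => z1; apply/sphereP; rewrite dotvZl dotvZr mulrA -invfM -expr2.
rewrite /norm2 sqr_sqrtr ?dotv_ge0// mulVf//.
by rewrite gt_eqF// (lt_le_trans _ z1).
Qed.

(** For unit vectors its square is half of the smaller of [|x - y|^2] and [|x + y|^2]. *)
Definition misalign x y : R := Num.sqrt (1 - `|dotv x y|).

Lemma misalignN x y : misalign x (- y) = misalign x y.
Proof. by rewrite /misalign dotvNr normrN. Qed.

Lemma misalign_ge0 x y : 0 <= misalign x y. Proof. exact: sqrtr_ge0. Qed.

Lemma misalign_le1 x y : misalign x y <= 1.
Proof. by rewrite /misalign -[leRHS]sqrtr1 ler_wsqrtr// gerBl. Qed.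

Lemma sqr_misalign x y : sphere d x -> sphere d y ->
  misalign x y ^+ 2 = 1 - `|dotv x y|.
Proof. by move=> Sx Sy; rewrite sqr_sqrtr// subr_ge0 dotv_sphere_le1. Qed.

Definition contraction_rate : R := Num.sqrt (1 + eta ^+ 2)^-1.

Lemma contraction_rate_gt0 : 0 < contraction_rate.
Proof. by rewrite sqrtr_gt0 invr_gt0 ltr_pwDl// sqr_ge0. Qed.

Lemma contraction_rate_lt1 : contraction_rate < 1.
Proof.
rewrite -[ltRHS]sqrtr1 ltr_sqrt// invf_lt1 ?ltrDl ?exprn_gt0//.
by rewrite ltr_pwDl// sqr_ge0.
Qed.

(* When [x] and [y] see [xi] on the same side both are translated by the same
   vector, so the chord [x - y] is unchanged before projection, and both norms
   become at least [sqrt (1 + eta ^+ 2)]. *)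
Lemma misalign_step x y xi :
  sphere d x -> sphere d y -> sphere d xi ->
  0 <= dotv x y -> 0 < dotv x xi * dotv y xi ->
  misalign (hjmr_step eta x xi) (hjmr_step eta y xi) <=
  contraction_rate * misalign x y.
Proof.
move=> Sx Sy /sphereP xi1 c0 ab0.
have := Sx; have := Sy; move=> /sphereP y1 /sphereP x1.
rewrite /misalign /contraction_rate -sqrtrM; last first.
  by rewrite invr_ge0 addr_ge0// sqr_ge0.
apply: ler_wsqrtr; rewrite (ger0_norm c0).
apply: le_trans (lerB (lexx _) (ler_norm _)) _.
have z1 := unnormalized_step_ge1 xi Sx.
have z2 := unnormalized_step_ge1 xi Sy.
rewrite /hjmr_step /proj_sphere !dotvE !(dotvC xi) !xi1.
have sab : Num.sg (dotv y xi) = Num.sg (dotv x xi).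
  case: (ltgtP (dotv x xi) 0) ab0 => [a0|a0|->]; last by rewrite mul0r ltxx.
    by rewrite nmulr_rgt0// => b0; rewrite !ltr0_sg.
  by rewrite pmulr_rgt0// => b0; rewrite !gtr0_sg.
have s2 : Num.sg (dotv x xi) ^+ 2 = 1.
  by rewrite sqr_sg; case: eqP ab0 => // ->; rewrite mul0r ltxx.
have sa : 0 <= Num.sg (dotv x xi) * dotv x xi by rewrite -normrEsg.
have sb : 0 <= Num.sg (dotv x xi) * dotv y xi by rewrite -sab -normrEsg.
rewrite /norm2; move: z1 z2; rewrite !dotvE !(dotvC xi) !xi1 sab x1 y1.
set s := Num.sg _ in s2 sa sb *.
move=> A1 B1; set A2 := 1 + eta * s * dotv x xi + _ in A1 *.
set B2 := 1 + eta * s * dotv y xi + _ in B1 *.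
have AA : Num.sqrt A2 ^+ 2 = A2 by rewrite sqr_sqrtr// (le_trans _ A1).
have BB : Num.sqrt B2 ^+ 2 = B2 by rewrite sqr_sqrtr// (le_trans _ B1).
have A0 : 0 < Num.sqrt A2 by rewrite sqrtr_gt0 (lt_le_trans _ A1).
have B0 : 0 < Num.sqrt B2 by rewrite sqrtr_gt0 (lt_le_trans _ B1).
have e2 : (eta * s) ^+ 2 = eta ^+ 2 by rewrite exprMn s2 mulr1.
have ea : 0 <= eta * (s * dotv x xi) by rewrite mulr_ge0// ltW.
have eb : 0 <= eta * (s * dotv y xi) by rewrite mulr_ge0// ltW.
have m0 : 0 < 1 + eta ^+ 2 by rewrite ltr_pwDl// sqr_ge0.
have Am : 1 + eta ^+ 2 <= A2 by rewrite /A2; lra.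
have Bm : 1 + eta ^+ 2 <= B2 by rewrite /B2; lra.
have c1 : dotv x y <= 1 by rewrite (le_trans (ler_norm _))// dotv_sphere_le1.
(* Polarization identity: [A2 + B2] minus twice the inner product of the translated vectors is the
   squared chord [2 - 2 <x, y>]. *)
have N2 : 2 * (dotv x y + eta * s * dotv x xi + eta * s * (dotv y xi + eta * s))
    = A2 + B2 - 2 + 2 * dotv x y by rewrite /A2 /B2; ring.
rewrite -AA -BB in Am Bm N2; clearbody A2 B2.
move: (Num.sqrt A2) (Num.sqrt B2) A0 B0 Am Bm N2 => A B A0 B0 Am Bm N2.
have AB0 : 0 < A * B by rewrite mulr_gt0.
have ABm : 1 + eta ^+ 2 <= A * B.
  rewrite -(@ler_pXn2r _ 2)//; [|by rewrite nnegrE ltW..]; rewrite exprMn [X in X <= _]expr2.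
  by apply: ler_pM => //; exact: ltW.
have -> : 1 - A^-1 * (B^-1 * (dotv x y + eta * s * dotv x xi) +
    eta * s * (B^-1 * (dotv y xi + eta * s * 1))) =
    (A * B)^-1 * (A * B - (A ^+ 2 + B ^+ 2 - 2 + 2 * dotv x y) / 2).
  by rewrite -N2; field; rewrite !gt_eqF.
(* [(A - B)^2 >= 0] absorbs the difference of the two norms; [A * B >= 1 + eta ^ 2] then gives the
   squared rate. *)
apply: (@le_trans _ _ ((A * B)^-1 * (1 - dotv x y))).
  rewrite ler_pM2l ?invr_gt0//; have := sqr_ge0 (A - B); lra.
by rewrite ler_wpM2r ?subr_ge0// lef_pV2.
Qed.
End step.

(** * Construction of the Lyapunov function *)

Section lyapunov.
Context {R : realType}.

(* [phi r = M * min 1 (k * r) + B - (max r (g / k)) `^ (- beta)]: the first term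
   yields the decrease for [r <= 1 / k], where failure has probability at most
   [K * r]; the second one for larger [r], where success has probability at least
   [q] and [beta] is such that [q * g `^ (- beta) >= 2]. *)
Lemma exists_lyapunov (g q K : R) : 0 < g -> g < 1 -> 0 < q -> 0 <= K ->
  exists phi : R -> R, [/\ forall x, 0 <= x -> 0 <= phi x,
    forall x y, x <= y -> phi x <= phi y &
    forall r b, 0 <= r -> r <= 1 -> 0 <= b -> b <= 1 - q -> b <= K * r ->
      (1 - b) * phi (g * r) + b * phi 1 <= phi r - r].
Proof.
move=> g0 g1 q0 K0.
(* Makes the failure bound [K * r] at most half of [k * (1 - g) * r], the amount by which a success
   lowers [k * r]. *)
pose k := 1 + 2 * K / (1 - g).
have g1' : 0 < 1 - g by rewrite subr_gt0.
have k1 : 1 <= k by rewrite lerDl divr_ge0// ?mulr_ge0// ltW.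
have k0 : 0 < k by rewrite (lt_le_trans _ k1).
have kK : 2 * K <= k * (1 - g).
  by rewrite [leRHS]mulrDl divfK ?gt_eqF// mul1r lerDr ltW.
pose beta := Num.max 0 (ln (2 / q) / - ln g).
have lng : 0 < - ln g by rewrite oppr_gt0 ln_lt0// g0.
have beta0 : 0 <= beta by rewrite le_max lexx.
pose p x : R := x `^ (- beta).
have p_ge0 x : 0 <= p x by exact: powR_ge0.
have p_anti x y : 0 < x -> x <= y -> p y <= p x.
  move=> x0 xy; have y0 := lt_le_trans x0 xy.
  by rewrite /p !powRN lef_pV2 ?posrE ?powR_gt0// ge0_ler_powR ?nnegrE// ltW.
have pM x y : 0 <= x -> 0 <= y -> p (x * y) = p x * p y by exact: powRM.
have p1 : p 1 = 1 by rewrite /p powR1.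
have pg : 2 / q <= p g.
  rewrite /p /powR gt_eqF// mulNr -mulrN -ler_ln ?posrE ?expR_gt0 ?divr_gt0//.
  by rewrite expRK -ler_pdivrMr// le_max lexx orbT.
(* With this cutoff the maximum in [u] is inactive at both [r] and [g * r] as soon as
   [r >= 1 / k]. *)
pose r1 := g / k.
have r10 : 0 < r1 by rewrite divr_gt0.
have r1g : r1 <= g by rewrite ler_pdivrMr// ler_peMr// ltW.
have r11 : r1 <= 1 by rewrite (le_trans r1g)// ltW.
pose B := p r1.
(* Solves [M * (k * (1 - g) / 2) = K * B + 1]: when [k * r <= 1] this pays for the possible growth
   [K * B * r] of [u] and leaves the required decrease [r]. *)
pose M := 2 * (K * B + 1) / (k * (1 - g)).
have kg0 : 0 < k * (1 - g) by rewrite mulr_gt0.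
have B0 : 0 <= B by exact: p_ge0.
have M0 : 0 <= M.
  by apply: divr_ge0; [rewrite mulr_ge0// addr_ge0// mulr_ge0|exact: ltW].
pose v r := Num.min 1 (k * r).
pose u r := B - p (Num.max r r1).
have v_homo x y : x <= y -> v x <= v y.
  by move=> xy; rewrite /v le_min !ge_min lexx/= ler_pM2l// xy orbT.
have u_homo x y : x <= y -> u x <= u y.
  move=> xy; rewrite lerB// p_anti ?lt_max ?r10 ?orbT//.
  by rewrite ge_max !le_max xy lexx !orbT.
have u0 x : 0 <= u x by rewrite subr_ge0 p_anti// le_max lexx orbT.
exists (fun r => M * v r + u r); split.
- by move=> x x0; rewrite addr_ge0// mulr_ge0// le_min ler01 mulr_ge0// ltW.
- by move=> x y xy; rewrite lerD ?u_homo// ler_wpM2l// v_homo.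
move=> r b r0 rle1 b0 bq bK.
have b1 : b <= 1 by rewrite (le_trans bq)// gerBl ltW.
have v1 : v 1 = 1 by rewrite /v mulr1 min_l.
have um : u 1 = B - 1 by rewrite /u max_l// p1.
have gr : g * r <= r by rewrite ler_piMl// ltW.
have vg : v (g * r) <= v r by exact: v_homo.
have ug : u (g * r) <= u r by exact: u_homo.
have [kr|kr] := leP (k * r) 1.
  have vr : v r = k * r by rewrite /v min_r.
  have vgr : v (g * r) = g * (k * r).
    by rewrite /v min_r mulrCA// mulr_ile1// ?mulr_ge0// ltW.
  rewrite v1 um vr vgr.
  have h1 : (1 - b) * u (g * r) + b * (B - 1) <= u r + K * r * B.
    have : (1 - b) * u (g * r) <= u r.
      rewrite (le_trans _ ug)// ler_piMl// gerBl//.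
    have : b * (B - 1) <= K * r * B.
      by apply: le_trans (ler_wpM2r B0 bK); rewrite ler_wpM2l// gerBl.
    lra.
  have h2 : M * (g * (k * r)) + M * b <= M * (k * r) - (K * B + 1) * r.
    have -> : (K * B + 1) * r = M * ((k * (1 - g)) / 2 * r).
      rewrite /M; field; by rewrite ?gt_eqF.
    rewrite -mulrBr -mulrDr ler_wpM2l//.
    have : b <= k * (1 - g) / 2 * r.
      by rewrite (le_trans bK)// ler_wpM2r// ler_pdivlMr// mulrC.
    lra.
  have h3 : 0 <= b * (M * (g * (k * r))).
    by apply: mulr_ge0 => //; apply: mulr_ge0 => //; rewrite !mulr_ge0// ltW.
  lra.
(* Now [v] is at its maximum 1 and the decrease comes from [u]: success contributes
   [(1 - b) * p (g * r) >= 2 * p r], and [p r >= 1 >= r]. *)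
have vr : v r = 1 by rewrite /v min_l// ltW.
have rk : k^-1 <= r by rewrite -[k^-1]mulr1 ler_pdivrMl// ltW.
have rp : 0 < r by rewrite (lt_le_trans _ rk)// invr_gt0.
have ur : u r = B - p r.
  rewrite /u max_l// (le_trans _ rk)// /r1 -[leRHS]mul1r ler_wpM2r// ltW//.
  by rewrite invr_gt0.
have ugr : u (g * r) = B - p g * p r.
  by rewrite /u max_l ?pM ?(ltW g0)// ler_wpM2l// ltW.
rewrite v1 um vr ugr ur.
have h1 : M * v (g * r) <= M by rewrite -[leRHS]mulr1 ler_wpM2l// -vr.
have pr1 : 1 <= p r by rewrite -p1 p_anti.
have h2 : 2 * p r <= (1 - b) * (p g * p r).
  rewrite mulrA ler_wpM2r//.
  have -> : 2 = q * (2 / q) by rewrite mulrC divfK// gt_eqF.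
  by apply: ler_pM => //; [exact: ltW|rewrite divr_ge0// ltW|lra].
have h3 : (1 - b) * (M * v (g * r)) <= (1 - b) * M by rewrite ler_wpM2l ?subr_ge0.
lra.
Qed.

End lyapunov.

(** * Distance to the polarized set in terms of pairwise misalignment *)

Section polarization_distance.
Context {R : realType}.

Lemma rho_ge0 n d (z : 'I_n -> 'rV[R]_d) : 0 <= rho z.
Proof.
(* For [d = 0] the polarized set is empty and [inf] takes its default value 0. *)
rewrite /rho; have [->|/set0P[y Py]] :=
    eqVneq (polarized n d) (set0 : set ('I_n -> 'rV[R]_d)).
  by rewrite image_set0 inf0.
apply: lb_le_inf; first by exists (distn z y), y.
by move=> _ [y' _ <-]; exact: sqrtr_ge0.
Qed.

(** The competitor gives every agent the opinion of agent [j], with the sign that brings it closer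
    to the agent's own opinion. *)
Lemma rho_le n d (z : 'I_n -> 'rV[R]_d) (j : 'I_n) : (forall i, sphere d (z i)) ->
  rho z <= Num.sqrt (2 * \sum_(i < n) misalign (z j) (z i) ^+ 2).
Proof.
move=> Sz; pose sigma i := dotv (z j) (z i) < 0.
pose y i := (-1) ^+ sigma i *: z j.
have -> : 2 * \sum_(i < n) misalign (z j) (z i) ^+ 2 =
    \sum_(i < n) dotv (z i - y i) (z i - y i).
  rewrite mulr_sumr; apply: eq_bigr => i _; rewrite sqr_misalign//.
  have /sphereP zi := Sz i; have /sphereP zj := Sz j.
  rewrite /y /sigma; case: ltP => c0; rewrite ?expr1 ?expr0 ?scaleN1r ?scale1r.
    by rewrite ltr0_norm// !opprK !dotvDl !dotvDr zi zj (dotvC (z i)); lra.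
  rewrite ger0_norm// !dotvDl !dotvDr !dotvNl !dotvNr zi zj (dotvC (z i)); lra.
apply: ge_inf; first by exists 0 => _ [y' _ <-]; exact: sqrtr_ge0.
by exists y => //; exists (z j); split => //; exists sigma.
Qed.

End polarization_distance.

(** * Measurability through coordinates *)

Section coordinates.
Context {R : realType}.

Lemma measurable_coord d (j : 'I_d) :
  measurable_fun [set: Rd R d] (fun x : Rd R d => (x : 'rV[R]_d) 0 j).
Proof.
apply: (measurability _ (RGenOInfty.measurableE R)) => /= _ [_ [a ->] <-].
rewrite setTI; apply: sub_sigma_algebra.
apply: open_comp => [x _|]; first exact: coord_continuous.
exact: interval_open.
Qed.

Context {dS : measure_display} {S : measurableType dS}.

(* The Borel sigma-algebra of [Rd R d] is generated by the coordinates, but only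
   real-valued functions of vectors ever get integrated, so measurability of the
   coordinates is all that is propagated. *)
Definition coord_measurable d (f : S -> 'rV[R]_d) :=
  forall j, measurable_fun [set: S] (fun s => f s 0 j).

Lemma coord_measurable_cst d (x : 'rV[R]_d) : coord_measurable (fun=> x).
Proof. by move=> j; exact: measurable_cst. Qed.

Lemma coord_measurableT d (f : S -> Rd R d) :
  measurable_fun setT f -> coord_measurable (f : S -> 'rV[R]_d).
Proof. by move=> mf j; exact: (measurableT_comp (@measurable_coord d j) mf). Qed.

Lemma measurable_dotv d (f g : S -> 'rV[R]_d) :
  coord_measurable f -> coord_measurable g ->
  measurable_fun setT (fun s => dotv (f s) (g s)).
Proof.
move=> mf mg; apply: measurable_sum => j.
exact: measurable_funM (mf j) (mg j).
Qed.

Lemma measurable_sqrtr (f : S -> R) :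
  measurable_fun setT f -> measurable_fun setT (fun s => Num.sqrt (f s)).
Proof.
apply: measurableT_comp; apply: nondecreasing_measurable => // x y.
exact: ler_wsqrtr.
Qed.

(** On nonnegative reals the inverse is the real power of exponent -1, also at 0, where both are
    0. *)
Lemma measurable_invr_ge0 (f : S -> R) : (forall s, 0 <= f s) ->
  measurable_fun setT f -> measurable_fun setT (fun s => (f s)^-1).
Proof.
move=> f0 mf; under eq_fun do rewrite -powR_inv1//.
exact: (measurableT_comp (measurable_powR _)).
Qed.

Lemma measurable_sgr (f : S -> R) :
  measurable_fun setT f -> measurable_fun setT (fun s => Num.sg (f s)).
Proof.
apply: measurableT_comp; apply: nondecreasing_measurable => // x y xy.
by case: (ltgtP x 0) xy => [x0|x0|->]; case: (ltgtP y 0) => [y0|y0|->];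
  rewrite ?sgr0 ?(ltr0_sg x0) ?(gtr0_sg x0) ?(ltr0_sg y0) ?(gtr0_sg y0); lra.
Qed.

Lemma measurable_misalign d (f g : S -> 'rV[R]_d) :
  coord_measurable f -> coord_measurable g ->
  measurable_fun setT (fun s => misalign (f s) (g s)).
Proof.
move=> mf mg; apply: measurable_sqrtr; apply: measurable_funB => //.
by apply: measurableT_comp => //; exact: measurable_dotv.
Qed.

Lemma coord_measurable_hjmr_step d (eta : R) (f g : S -> 'rV[R]_d) :
  coord_measurable f -> coord_measurable g ->
  coord_measurable (fun s => hjmr_step eta (f s) (g s)).
Proof.
move=> mf mg; rewrite /hjmr_step /proj_sphere.
have mz : coord_measurable
    (fun s => f s + (eta * Num.sg (dotv (f s) (g s))) *: g s).
  move=> j; under eq_fun do rewrite !mxE.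
  apply: measurable_funD => //; apply: measurable_funM => //.
  apply: measurable_funM => //; apply: measurable_sgr; exact: measurable_dotv.
move=> j; under eq_fun do rewrite mxE.
apply: measurable_funM (mz j).
apply: measurable_invr_ge0 => [s|]; first exact: sqrtr_ge0.
by apply: measurable_sqrtr; exact: measurable_dotv.
Qed.

End coordinates.

(** * Householder reflections *)

Section reflection.
Context {R : realType} {d : nat}.
Implicit Types (v x y xi : 'rV[R]_d).

Definition reflection v xi := xi - (2 * dotv xi v) *: v.

Definition reflection_mx v : 'M[R]_d := 1%:M - 2 *: (v^T *m v).

Lemma mulmx_trE x y : x *m y^T = (dotv x y)%:M.
Proof.
apply/matrixP => i j; rewrite !ord1 !mxE eqxx mulr1n.
by apply: eq_bigr => k _; rewrite mxE.
Qed.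

Lemma mulmx_reflection v xi : xi *m reflection_mx v = reflection v xi.
Proof.
rewrite mulmxBr mulmx1 -scalemxAr mulmxA mulmx_trE mul_scalar_mx scalerA.
by [].
Qed.

(** [W] is a symmetric idempotent, the projection onto the line of [v], so [1 - 2 W] is symmetric
    and squares to the identity. *)
Lemma reflection_mx_orthogonal v : sphere d v ->
  reflection_mx v *m (reflection_mx v)^T = 1%:M.
Proof.
move=> /sphereP v1; rewrite /reflection_mx; set W := v^T *m v.
have WT : W^T = W by rewrite trmx_mul trmxK.
have WW : W *m W = W by rewrite mulmxA -(mulmxA v^T) mulmx_trE v1 mulmx1.
have -> : (1%:M - 2 *: W)^T = 1%:M - 2 *: W by rewrite linearB linearZ /= trmx1 WT.
rewrite mulmxBl mul1mx mulmxBr mulmx1.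
rewrite -scalemxAl -scalemxAr WW scalerA.
have -> : (2 * 2 : R) *: W = 2 *: W + 2 *: W by rewrite -scalerDl; congr (_ *: _); ring.
by rewrite opprB addrK subrK.
Qed.

(** Self-adjointness turns a reflection of the random direction into a reflection of the normal
    vectors defining hyperplanes and wedges. *)
Lemma dotv_reflection v x xi : dotv x (reflection v xi) = dotv (reflection v x) xi.
Proof.
by rewrite /reflection dotvDr dotvDl dotvNr dotvNl dotvZr dotvZl (dotvC xi v); ring.
Qed.

(* Reflecting in the bisector of [x] and [y]. *)
Lemma exists_reflection x y : sphere d x -> sphere d y -> x != y ->
  exists2 v, sphere d v & reflection v x = y.
Proof.
move=> /sphereP x1 /sphereP y1; rewrite -subr_eq0 -dotv_eq0.
set w := x - y => w0; have w_gt0 : 0 < dotv w w by rewrite lt0r w0 dotv_ge0.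
have n2 : norm2 w * norm2 w = dotv w w by rewrite -expr2 sqr_sqrtr// ltW.
have n0 : norm2 w != 0 by apply: contraNneq w0 => n0; rewrite -n2 n0 mulr0.
exists ((norm2 w)^-1 *: w).
  by apply/sphereP; rewrite dotvZl dotvZr mulrA -invfM n2 mulVf.
rewrite /reflection dotvZr scalerA.
have -> : 2 * ((norm2 w)^-1 * dotv x w) * (norm2 w)^-1 = 1.
  have -> : 2 * ((norm2 w)^-1 * dotv x w) * (norm2 w)^-1 =
    2 * dotv x w / dotv w w by rewrite -n2; field.
  have -> : 2 * dotv x w = dotv w w; last by rewrite divff.
  by rewrite /w !dotvDl !dotvDr !dotvNl !dotvNr x1 y1 (dotvC y x); ring.
by rewrite scale1r opprB addrC addrNK.
Qed.

End reflection.

Lemma measureI_full {R : realType} {dT} {T : measurableType dT}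
    (m : {measure set T -> \bar R}) (D A : set T) :
  measurable D -> measurable A -> m (~` D) = 0%E -> m (A `&` D) = m A.
Proof.
move=> mD mA D0; rewrite [RHS](measureDI m mA mD).
rewrite (@subset_measure0 _ _ _ m (A `\` D) (~` D)) ?add0e//.
- exact: measurableD.
- exact: measurableC.
Qed.

(** * Uniform measure of hyperplanes and double wedges *)

Section uniform_measure.
Context {R : realType} {d : nat} (mu : probability (Rd R d) R).
Hypothesis mu_unif : uniform_sphere_measure mu.
Implicit Types (v x y xi : 'rV[R]_d) (A : set (Rd R d)).

Lemma measure_reflection v A : sphere d v -> measurable A ->
  mu (reflection v @^-1` A) = mu A.
Proof.
move=> Sv mA; case: mu_unif => _ /(_ _ (reflection_mx_orthogonal Sv) _ mA) <-.
by congr (mu _); apply/seteqP; split => xi/=; rewrite mulmx_reflection.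
Qed.

Let mdot x : measurable_fun [set: Rd R d] (fun xi : Rd R d => dotv x xi).
Proof.
apply: measurable_dotv; first exact: coord_measurable_cst.
by move=> j; exact: measurable_coord.
Qed.

Definition hyperplane x : set (Rd R d) := [set xi | dotv x xi = 0].
Definition wedge x y : set (Rd R d) := [set xi | dotv x xi * dotv y xi < 0].

Lemma measurable_sphere : measurable (sphere d : set (Rd R d)).
Proof.
have mn : measurable_fun [set: Rd R d] (fun xi : Rd R d => norm2 (xi : 'rV[R]_d)).
  apply: measurable_sqrtr; apply: measurable_dotv => j; exact: measurable_coord.
rewrite -[X in measurable X]setTI.
exact: (mn measurableT [set 1] (measurable_set1 _)).
Qed.

Lemma measurable_hyperplane x : measurable (hyperplane x).
Proof.
rewrite -[X in measurable X]setTI.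
exact: (@mdot x measurableT [set 0] (measurable_set1 _)).
Qed.

Lemma measurable_wedge x y : measurable (wedge x y).
Proof.
have m : measurable_fun [set: Rd R d] (fun xi : Rd R d => dotv x xi * dotv y xi).
  exact: measurable_funM.
have := m measurableT `]-oo, 0[%classic (measurable_itv _).
by rewrite setTI; congr measurable; apply/seteqP; split => xi /=; rewrite in_itv.
Qed.

Lemma measure_hyperplane_eq x y : sphere d x -> sphere d y ->
  mu (hyperplane x) = mu (hyperplane y).
Proof.
have [->//|xy Sx Sy] := eqVneq x y.
have [v Sv <-] := exists_reflection Sx Sy xy.
rewrite -(measure_reflection Sv (measurable_hyperplane x)).
by congr (mu _); apply/seteqP; split => xi; rewrite /hyperplane/= dotv_reflection.
Qed.

(** Up to sign [z] is the reflection of [x] in the hyperplane orthogonal to [y], whence the equal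
    measures; [<x, y> >= 0] gives both the disjointness and the inclusion. *)
Lemma measure_wedge_double x y : sphere d x -> sphere d y -> 0 <= dotv x y ->
  (mu (wedge x y) + mu (wedge x y) <=
   mu (wedge x ((2 * dotv x y) *: y - x)))%E.
Proof.
move=> Sx Sy c0; set z := _ - x.
have wyz : mu (wedge x y) = mu (wedge z y).
  rewrite -(measure_reflection Sy (measurable_wedge x y)).
  have -> : z = - reflection y x by rewrite /reflection opprB.
  have ry : reflection y y = - y.
    move/sphereP: Sy => y1; rewrite /reflection y1 mulr1.
    by rewrite scaler_nat mulr2n opprD addrA subrr sub0r.
  congr (mu _); apply/seteqP; split => xi; rewrite /wedge/= !dotv_reflection ry.
    by rewrite !dotvNl mulrN mulNr.
  by rewrite !dotvNl mulrN mulNr.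
rewrite [in leLHS]wyz addeC -[in X in (X + _ <= _)%E]wyz -measureU.
- apply: le_measure; rewrite ?inE; [|exact: measurable_wedge|].
    by apply: measurableU; exact: measurable_wedge.
  move=> xi; rewrite /wedge/= /z dotvDl dotvNl dotvZl.
  move: (dotv x xi) (dotv y xi) (dotv x y) c0 => a b c c0 [] h.
    rewrite mulrBr mulrCA -expr2 subr_lt0 (@le_lt_trans _ _ 0)//.
      by rewrite mulr_ge0_le0 ?mulr_ge0// ltW.
    by rewrite exprn_even_gt0//=; apply: contraTneq h => ->; rewrite mul0r ltxx.
  (* From [(2 c b - a) b < 0] follows [a b > 2 c b^2 >= 0]; multiplying [a (2 c b - a)] by [b^2]
     then leaves factors of known sign. *)
  have b0 : 0 < b ^+ 2.
    by rewrite exprn_even_gt0//=; apply: contraTneq h => ->; rewrite mulr0 ltxx.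
  have ab : 0 < a * b by have := mulr_ge0 c0 (ltW b0); nra.
  rewrite -(pmulr_llt0 _ b0).
  have -> : a * (2 * c * b - a) * b ^+ 2 = (2 * c * b - a) * b * (a * b) by ring.
  by rewrite pmulr_llt0.
- exact: measurable_wedge.
- exact: measurable_wedge.
apply/seteqP; split => xi //; rewrite /wedge/= /z dotvDl dotvNl dotvZl.
by move: (dotv x xi) (dotv y xi) => a b [] h1 h2; nra.
Qed.

Definition moment_curve (k : nat) : 'rV[R]_d := \row_j k%:R ^+ j.

Lemma dotv_moment_curve k xi : dotv (moment_curve k) xi = (rVpoly xi).[k%:R].
Proof.
rewrite /rVpoly horner_poly; apply: eq_bigr => j _.
by rewrite mxE valK mulrC.
Qed.

(** The counted indices are distinct roots of the nonzero polynomial [rVpoly xi], whose size is at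
    most [d]. *)
Lemma count_moment_curve (N : nat) xi : xi != 0 ->
  (\sum_(k < N) (dotv (moment_curve k) xi == 0%R) <= d)%N.
Proof.
move=> xi0; set s := [seq k%:R : R | k <- iota 0 N & dotv (moment_curve k) xi == 0%R].
have p0 : rVpoly xi != 0.
  by apply: contraNneq xi0 => p0; rewrite -[xi]rVpolyK p0 linear0.
have -> : (\sum_(k < N) (dotv (moment_curve k) xi == 0%R))%N = size s.
  rewrite size_map size_filter -sum1_count -big_mkcond/=.
  by rewrite -(big_mkord (fun k => dotv (moment_curve k) xi == 0%R) (fun=> 1%N)) /index_iota subn0.
apply: leq_trans (size_poly _ _); apply: ltnW; apply: max_poly_roots p0 _ _.
  apply/allP => _ /mapP[k + ->]; rewrite mem_filter => /andP[/eqP k0 _].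
  by rewrite /root -dotv_moment_curve k0.
rewrite map_inj_uniq ?filter_uniq ?iota_uniq// => i j /eqP.
by rewrite eqr_nat => /eqP.
Qed.

(* All hyperplanes have the same measure, and a unit vector is orthogonal to at
   most [d] of the points of the moment curve. *)
Lemma measure_hyperplane x : (0 < d)%N -> sphere d x -> mu (hyperplane x) = 0%E.
Proof.
move=> d0 Sx.
have h_fin : mu (hyperplane x) \is a fin_num.
  by rewrite fin_num_measure//; exact: measurable_hyperplane.
have hk k : mu (hyperplane (moment_curve k)) = mu (hyperplane x).
  (* The coordinate of index 0 is [k ^ 0 = 1], even for [k = 0]. *)
  have m0 : moment_curve k != 0.
    apply/eqP => /rowP/(_ (Ordinal d0)); rewrite !mxE expr0.
    by apply/eqP; rewrite oner_eq0.
  have mm : 0 < dotv (moment_curve k) (moment_curve k).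
    by rewrite lt0r dotv_eq0 m0 dotv_ge0.
  have n0 : norm2 (moment_curve k) != 0 by rewrite gt_eqF// sqrtr_gt0.
  have Sm : sphere d (proj_sphere (moment_curve k)).
    apply/sphereP; rewrite /proj_sphere dotvZl dotvZr mulrA -invfM -expr2.
    by rewrite sqr_sqrtr ?ltW// mulVf// gt_eqF.
  rewrite (measure_hyperplane_eq Sx Sm); congr (mu _).
  apply/seteqP; split => xi; rewrite /hyperplane/= /proj_sphere dotvZl.
    by move=> ->; rewrite mulr0.
  by move=> /eqP; rewrite mulf_eq0 invr_eq0 (negbTE n0) => /eqP.
have mS := measurable_sphere.
have muS : mu (~` sphere d) = 0%E by case: mu_unif.
pose f k (xi : Rd R d) : \bar R := (\1_(hyperplane (moment_curve k)) xi)%:E.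
have mf k : measurable_fun (sphere d : set (Rd R d)) (f k).
  apply/measurable_EFinP; apply: measurable_funTS.
  exact: measurable_indic (measurable_hyperplane _).
have h0 : 0 <= fine (mu (hyperplane x)) by exact: fine_ge0.
(* Double counting: the integral of the number of hyperplanes through [xi] is [N] times their common
   measure, and at most [d]. Integrating over the sphere excludes [xi = 0]. *)
have bound (N : nat) : N%:R * fine (mu (hyperplane x)) <= d%:R.
  rewrite -lee_fin EFinM fineK//.
  have -> : (N%:R%:E * mu (hyperplane x) =
      \int[mu]_(xi in sphere d) \sum_(k < N) f k xi)%E.
    rewrite ge0_integral_sum//; last by move=> k xi _; rewrite lee_fin.
    rewrite -(fineK h_fin) -EFinM mulr_natl -[in LHS](card_ord N) -sumr_const.
    rewrite -sumEFin; apply: eq_bigr => k _.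
    rewrite fineK// integral_indic//; last exact: measurable_hyperplane.
    rewrite (measureI_full mS (measurable_hyperplane _) muS).
    exact/esym/hk.
  apply: (@le_trans _ _ (\int[mu]_(xi in sphere d) (cst d%:R%:E xi))%E).
    apply: ge0_le_integral => //.
    - by move=> xi _; apply: sume_ge0 => k _; rewrite lee_fin.
    - exact: emeasurable_sum.
    move=> xi Sxi; rewrite sumEFin lee_fin /=.
    have xi0 : xi != 0.
      apply: contraPneq Sxi => -> /sphereP.
      by move/eqP; rewrite -[X in dotv X _](scale0r 0) dotvZl mul0r eq_sym oner_eq0.
    have := count_moment_curve N xi0; rewrite -(ler_nat R) natr_sum.
    apply: le_trans; rewrite ler_sum// => k _.
    rewrite indicE ler_nat.
    case: (eqVneq (dotv (moment_curve k) xi) 0) => [_|/eqP Hk]; first exact: leq_b1.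
    by rewrite memNset.
  rewrite integral_cst// -[leRHS]mule1 lee_pmul2l ?probability_le1//.
  by rewrite lte_fin ltr0n.
apply/eqP; rewrite -(fineK h_fin) eqe eq_le h0 andbT leNgt; apply/negP => hp.
have := bound (Num.bound (d%:R / fine (mu (hyperplane x)))).
apply/negP; rewrite -ltNge -ltr_pdivrMr//.
by apply: archi_boundP; rewrite divr_ge0.
Qed.

Lemma fine_measure_wedge_double x y : sphere d x -> sphere d y ->
  0 <= dotv x y ->
  2 * fine (mu (wedge x y)) <= fine (mu (wedge x ((2 * dotv x y) *: y - x))).
Proof.
move=> Sx Sy c0; have mw := measurable_wedge.
rewrite mulr_natl mulr2n -lee_fin EFinD !fineK ?fin_num_measure//.
exact: measure_wedge_double.
Qed.

Lemma fine_measure_wedge_half x y : sphere d x -> sphere d y ->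
  0 <= dotv x y -> fine (mu (wedge x y)) <= 2^-1.
Proof.
move=> Sx Sy c0; have := fine_measure_wedge_double Sx Sy c0.
set z := _ - x; have mw := measurable_wedge x z.
have : fine (mu (wedge x z)) <= 1.
  by rewrite -lee_fin fineK ?fin_num_measure// probability_le1.
lra.
Qed.

(** Iterated angle doubling: the bound is first proved with an error [2^-k], trivial for [k = 0].
    Passing from [y] to [z] at least doubles the wedge and at most doubles the misalignment, so the
    error is halved; then [k] tends to infinity. *)
Lemma fine_measure_wedge_misalign x y : sphere d x -> sphere d y ->
  0 <= dotv x y -> fine (mu (wedge x y)) <= 2 * misalign x y.
Proof.
move=> Sx Sy c0; have mw := measurable_wedge.
suff bound k : fine (mu (wedge x y)) <= 2 * misalign x y + 2^-1 ^+ k.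
  have lim : (fun k => 2 * misalign x y + 2^-1 ^+ k) @ \oo --> 2 * misalign x y.
    rewrite -[X in _ --> X]addr0; apply: cvgD; first exact: cvg_cst.
    by apply: cvg_expr; rewrite ger0_norm ?invr_ge0// invf_lt1// ltr1n.
  rewrite -(cvg_lim _ lim)//; apply: limr_ge; first exact: cvgP lim.
  by apply: nearW => k; exact: bound.
elim: k => [|k IH] in x y Sx Sy c0 *.
  rewrite expr0 -lee_fin fineK ?fin_num_measure//.
  by rewrite (le_trans (probability_le1 _ _))// lee_fin lerDr mulr_ge0 ?misalign_ge0.
set r := misalign x y; have r0 : 0 <= r by exact: misalign_ge0.
have r2 : r ^+ 2 = 1 - dotv x y by rewrite sqr_misalign// ger0_norm.
have w1 : fine (mu (wedge x y)) <= 1.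
  by rewrite -lee_fin fineK ?fin_num_measure// probability_le1.
have h0 : 0 <= 2^-1 ^+ k.+1 :> R by rewrite exprn_ge0// invr_ge0.
have [rh|rh] := leP 2^-1 r; first lra.
set z := (2 * dotv x y) *: y - x.
(* This keeps [<x, z> = 2 <x, y>^2 - 1] nonnegative, as the induction hypothesis demands; for
   [r >= 1/2] the bound was trivial. *)
have c34 : 3 / 4 <= dotv x y by have : r ^+ 2 <= 1 / 4 by [nra]; lra.
have xz : dotv x z = 2 * dotv x y ^+ 2 - 1.
  by move/sphereP: Sx => x1; rewrite dotvDr dotvNr dotvZr x1; ring.
have Sz : sphere d z.
  move/sphereP: (Sx) => x1; move/sphereP: (Sy) => y1; apply/sphereP.
  by rewrite !dotvDl !dotvDr !dotvNl !dotvNr !dotvZl !dotvZr x1 y1 (dotvC y x); ring.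
have z0 : 0 <= dotv x z by rewrite xz; nra.
(* With [c = <x, y> <= 1], the square of the left side is [2 (1 - c) (1 + c) <= 4 (1 - c)]. *)
have rz : misalign x z <= 2 * r.
  rewrite -(@ler_pXn2r _ 2)// ?nnegrE ?misalign_ge0 ?mulr_ge0//.
  rewrite sqr_misalign// ger0_norm// xz exprMn r2.
  have := dotv_sphere_le1 Sx Sy; rewrite ger0_norm//; nra.
have := fine_measure_wedge_double Sx Sy c0.
have := IH x z Sx Sz z0; rewrite exprS -/z; lra.
Qed.

(** The sphere is built in because the contraction estimate requires a unit [xi]. *)
Definition aligned x y : set (Rd R d) :=
  sphere d `&` [set xi | 0 < dotv x xi * dotv y xi].

Lemma measurable_aligned x y : measurable (aligned x y).
Proof.
apply: measurableI; first exact: measurable_sphere.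
have := measurable_wedge x (- y); congr measurable.
by apply/seteqP; split => xi; rewrite /wedge/= dotvNl mulrN oppr_lt0.
Qed.

(** Outside the wedge, failure of alignment means leaving the sphere or lying on one of two
    hyperplanes, all null sets. *)
Lemma fine_measure_not_aligned x y : (0 < d)%N -> sphere d x -> sphere d y ->
  fine (mu (~` aligned x y)) <= fine (mu (wedge x y)).
Proof.
move=> d0 Sx Sy; have mh := measurable_hyperplane; have mw := measurable_wedge.
have mS := measurable_sphere; have ma := measurable_aligned.
have muS : mu (~` sphere d) = 0%E by case: mu_unif.
rewrite fine_le ?fin_num_measure//; first exact: measurableC.
pose N : set (Rd R d) := ~` sphere d `|` (hyperplane x `|` hyperplane y).
have mN : measurable N.
  by apply: measurableU; [exact: measurableC|exact: measurableU].
have N0 : mu N = 0%E.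
  apply/eqP; rewrite eq_le measure_ge0 andbT.
  apply: (le_trans (measureU2 _ _ _)); [exact: measurableC|exact: measurableU|].
  rewrite /= muS add0e; apply: (le_trans (measureU2 _ _ _)) => //.
  by rewrite /= (measure_hyperplane d0 Sx) (measure_hyperplane d0 Sy) adde0.
apply: (@le_trans _ _ (mu (N `|` wedge x y))).
  apply: le_measure; rewrite ?inE; [exact: measurableC|exact: measurableU|].
  move=> xi; rewrite /aligned/= => /not_andP[|/negP]; first by left; left.
  rewrite -leNgt le_eqVlt mulf_eq0 => /orP[/orP[|]/eqP|].
  - by left; right; left.
  - by left; right; right.
  - by right.
by apply: (le_trans (measureU2 _ _ _)) => //; rewrite /= N0 add0e.
Qed.

End uniform_measure.

(** * Transfer of the success bounds to the law of the interactions *)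

Section success.
Context {R : realType} {d : nat} (mu nu : probability (Rd R d) R).
Variables (eta C C' : R).
Hypotheses (d0 : (0 < d)%N) (eta0 : 0 < eta) (C0 : 0 < C) (C'0 : 0 < C').
Hypothesis mu_unif : uniform_sphere_measure mu.
Hypothesis nu_sphere : nu (~` sphere d) = 0%E.
Hypothesis nu_mu : forall A : set (Rd R d), measurable A -> A `<=` sphere d ->
  (C%:E * mu A <= nu A <= C'%:E * mu A)%E.
Implicit Types x y : 'rV[R]_d.

Let fine_nu_le (A : set (Rd R d)) : measurable A -> A `<=` sphere d ->
  fine (nu A) <= C' * fine (mu A).
Proof.
move=> mA AS; have /andP[_] := nu_mu mA AS.
by rewrite -(fineK (fin_num_measure nu A mA)) -(fineK (fin_num_measure mu A mA)).
Qed.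

Let fine_nu_ge (A : set (Rd R d)) : measurable A -> A `<=` sphere d ->
  C * fine (mu A) <= fine (nu A).
Proof.
move=> mA AS; have /andP[+ _] := nu_mu mA AS.
by rewrite -(fineK (fin_num_measure nu A mA)) -(fineK (fin_num_measure mu A mA)).
Qed.

Let fineC (m : probability (Rd R d) R) (A : set (Rd R d)) : measurable A ->
  fine (m (~` A)) = 1 - fine (m A).
Proof.
by move=> mA; rewrite probability_setC// fineB ?fin_num_measure.
Qed.

(** The lower comparison with [mu] gives success probability at least [C / 2], since alignment has
    uniform measure at least one half; the upper one makes failure linear in the misalignment. *)
Lemma exists_success x y : sphere d x -> sphere d y ->
  exists2 G : set (Rd R d), measurable G & [/\ forall xi, G xi ->
      misalign (hjmr_step eta x xi) (hjmr_step eta y xi) <=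
      contraction_rate eta * misalign x y,
    fine (nu (~` G)) <= 1 - C / 2 &
    fine (nu (~` G)) <= 2 * C' * misalign x y].
Proof.
wlog c0 : y / 0 <= dotv x y.
  move=> wlog_c0; have [|/ltW c0 Sx Sy] := leP 0 (dotv x y); first exact: wlog_c0.
  have [||//|G mG [h1 h2 h3]] := wlog_c0 (- y); rewrite ?dotvNr ?oppr_ge0//.
    exact: sphereN.
  exists G => //; rewrite -(misalignN x y); split => // xi Gxi.
  by have := h1 xi Gxi; rewrite hjmr_stepN misalignN.
move=> Sx Sy; have mG := measurable_aligned x y; exists (aligned x y) => //.
have mS : measurable (sphere d : set (Rd R d)) := measurable_sphere.
have hle := fine_measure_not_aligned mu_unif d0 Sx Sy.
split.
- by move=> xi [Sxi]; exact: misalign_step.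
- rewrite fineC// lerB//; apply: le_trans (fine_nu_ge mG _); last by move=> ? [].
  rewrite ler_pM2l//; have := fineC mu mG.
  have := fine_measure_wedge_half mu_unif Sx Sy c0; lra.
(* The comparison of [nu] with [mu] is available only for subsets of the sphere. *)
have -> : fine (nu (~` aligned x y)) = fine (nu (~` aligned x y `&` sphere d)).
  by rewrite [in RHS](measureI_full mS (measurableC mG) nu_sphere).
apply: (@le_trans _ _ (C' * fine (mu (~` aligned x y `&` sphere d)))).
  by apply: fine_nu_le => [|? []//]; apply: measurableI => //; exact: measurableC.
have -> : 2 * C' * misalign x y = C' * (2 * misalign x y) by ring.
rewrite ler_pM2l// (measureI_full mS (measurableC mG)); last by case: mu_unif.
by apply: le_trans hle _; exact: fine_measure_wedge_misalign.
Qed.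

End success.

(** * Integration of independent variables *)

Section independence.
Context {R : realType} {dT dS dU : measure_display} {T : measurableType dT}
  {S : measurableType dS} {U : measurableType dU} (P : probability T R).

(** Agreement on rectangles makes the joint law the product of the two laws, and Tonelli integrates
    out [X]. This serves in place of conditioning on [Y]. *)
Lemma integral_independent (Y : {mfun T >-> S}) (X : {mfun T >-> U})
    (f : S * U -> \bar R) :
  (forall A B, measurable A -> measurable B ->
     P (Y @^-1` A `&` X @^-1` B) = (P (Y @^-1` A) * P (X @^-1` B))%E) ->
  measurable_fun setT f -> (forall p, 0 <= f p)%E ->
  (\int[P]_w f (Y w, X w) = \int[P]_w \int[distribution P X]_u f (Y w, u))%E.
Proof.
move=> ind mf f0.
have mZ : measurable_fun setT (fun w => (Y w, X w)) by exact: measurable_fun_pair.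
pose Z : {mfun T >-> (S * U)%type} := HB.pack (fun w => (Y w, X w))
  (isMeasurableFun.Build _ _ _ _ _ mZ).
transitivity (\int[distribution P Z]_p f p)%E.
  by rewrite ge0_integral_distribution.
transitivity (\int[distribution P Y \x distribution P X]_p f p)%E.
  apply: eq_measure_integral => A mA _; apply/esym.
  by apply: product_measure_unique mA => B D mB mD; exact: ind.
rewrite fubini_tonelli1// ge0_integral_distribution//.
- exact: measurable_fun_fubini_tonelli_F.
- by move=> s; apply: integral_ge0.
Qed.

End independence.

(** * The sigma-algebra of the past *)

Section past.
Context {R : realType} {d : nat} {dT : measure_display} {T : measurableType dT}.
Variables (P : probability T R) (xi : nat -> T -> Rd R d).
Hypothesis mxi : forall t, measurable_fun setT (xi t).
Hypothesis xi_indep : mutually_independent P xi.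

Definition past_events (t : nat) : set_system T :=
  [set E | exists2 A : nat -> set (Rd R d), forall i, measurable (A i) &
    E = \big[setI/setT]_(i <- iota 0 t) (xi i @^-1` A i)].

(** The points of [T] with the sigma-algebra of [xi 0, ..., xi (t - 1)]; as a type of its own it can
    be a factor of a product measure. *)
Definition past t := g_sigma_algebraType (past_events t).

Let mpre t (A : set (Rd R d)) : measurable A -> measurable (xi t @^-1` A).
Proof. by move=> mA; rewrite -[X in measurable X]setTI; exact: mxi. Qed.

Lemma past_eventsI t : setI_closed (past_events t).
Proof.
move=> _ _ [A mA ->] [B mB ->]; exists (fun i => A i `&` B i).
  by move=> i; exact: measurableI.
by rewrite -big_split.
Qed.

Lemma past_eventsT t : past_events t setT.
Proof. by exists (fun=> setT) => //; rewrite big1. Qed.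

Lemma past_events_measurable t E : past_events t E -> measurable E.
Proof.
by move=> [A mA ->]; apply: bigsetI_measurable => i _; exact: mpre.
Qed.

Lemma measurable_past t : measurable_fun setT (id : T -> past t).
Proof.
move=> _ A mA; rewrite setTI; move: A mA; apply: smallest_sub.
  exact: sigma_algebra_measurable.
exact: past_events_measurable.
Qed.

(** For fixed [B] both sides are finite measures in [A] that agree on the generating pi-system of
    cylinder events. *)
Lemma past_independent t (A : set (past t)) (B : set (Rd R d)) :
  measurable A -> measurable B ->
  P (A `&` xi t @^-1` B) = (P A * P (xi t @^-1` B))%E.
Proof.
move=> mA mB; have mE := mpre t mB.
have r0 : 0 <= fine (P (xi t @^-1` B)) by exact: fine_ge0.
pose m1 := mrestr P mE; pose m2 := mscale (NngNum r0) P.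
have m2E D : m2 D = (P D * P (xi t @^-1` B))%E.
  by rewrite /m2 /mscale/= fineK ?fin_num_measure// muleC.
rewrite -m2E -[LHS]/(m1 A).
apply: (@g_sigma_algebra_measure_unique _ _ _ (past_events t) _ (fun=> setT)) mA.
- by move=> E; exact: past_events_measurable.
- by move=> _; exact: past_eventsT.
- exact: bigcup_const.
- exact: past_eventsI.
- move=> _ [D mD ->].
  transitivity (P (\big[setI/setT]_(i <- iota 0 t) (xi i @^-1` D i) `&`
      xi t @^-1` B)); first by [].
  transitivity (P (\big[setI/setT]_(i <- iota 0 t) (xi i @^-1` D i)) *
      P (xi t @^-1` B))%E; last by rewrite -m2E.
  (* One family for two uses of mutual independence, over the times [t, 0, ..., t - 1] and over
     [0, ..., t - 1]. *)
  pose D' i := if i == t then B else D i.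
  have D't : D' t = B by rewrite /D' eqxx.
  have D'i i : i \in iota 0 t -> D' i = D i.
    by rewrite mem_iota add0n /D' => /andP[_ it]; rewrite ltn_eqF.
  have mD' i : measurable (D' i) by rewrite /D'; case: ifP.
  have /= := xi_indep (s := t :: iota 0 t) (A := D').
  rewrite mem_iota add0n ltnn andbF iota_uniq => /(_ isT (fun i _ => mD' i)).
  have := xi_indep (iota_uniq 0 t) (fun i _ => mD' i).
  rewrite !big_cons D't => <-.
  under eq_big_seq => i it do rewrite D'i//.
  by rewrite setIC muleC.
- by move=> _; rewrite -[ltLHS]/(P (setT `&` xi t @^-1` B)) setTI ltey_eq
    fin_num_measure.
Qed.

Lemma measurable_past_xi s t : (s < t)%N ->
  measurable_fun [set: past t] (xi s : past t -> Rd R d).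
Proof.
move=> st _ B mB; rewrite setTI; apply: sub_sigma_algebra.
exists (fun i => if i == s then B else setT) => [i|]; first by case: ifP.
rewrite (bigD1_seq s) ?iota_uniq ?mem_iota//= eqxx big1 ?setIT// => i /negbTE ->.
exact: preimage_setT.
Qed.

End past.

(** * Trajectories as functions of the past *)

Section trajectory.
Context {R : realType} {n d : nat} {dT : measure_display} {T : measurableType dT}.
Variables (xi : nat -> T -> Rd R d) (eta : R) (X0 : 'I_n -> 'rV[R]_d).

Definition traj t (w : T) : 'I_n -> 'rV[R]_d :=
  hjmr_traj eta X0 (fun s => xi s w) t.

Lemma sphere_traj t w i : 0 < eta -> (forall j, sphere d (X0 j)) ->
  sphere d (traj t w i).
Proof.
by move=> eta0 SX; elim: t => [|t IH]; [exact: SX|exact: sphere_hjmr_step].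
Qed.

(** Opinions at time [s] depend on [xi 0, ..., xi (s - 1)] only, so [s = t] is allowed. Fixing [t]
    lets the induction on [s] stay in one sigma-algebra. *)
Lemma measurable_traj s t i : (s <= t)%N ->
  coord_measurable (fun w : past xi t => traj s w i).
Proof.
elim: s => [_|s IH st] /=; first exact: coord_measurable_cst.
apply: coord_measurable_hjmr_step; first exact: IH (ltnW st).
by apply: coord_measurableT; exact: measurable_past_xi.
Qed.

End trajectory.

(** * Almost sure convergence from summable expectations *)

Section summable.
Context {R : realType} {dT : measure_display} {T : measurableType dT}.
Variables (P : {measure set T -> \bar R}) (u : nat -> T -> R) (c : R).
Hypothesis mu_ : forall t, measurable_fun setT (u t).
Hypothesis u0 : forall t w, 0 <= u t w.
Hypothesis sum_le : forall N, (\sum_(t < N) \int[P]_w (u t w)%:E <= c%:E)%E.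

(** By monotone convergence the sum of the series has finite integral, so it is almost surely finite
    and its terms tend to 0. *)
Lemma ae_cvg0_of_sum_integral : {ae P, forall w, u ^~ w @ \oo --> (0 : R)}.
Proof.
pose S w := (\sum_(0 <= t <oo) (u t w)%:E)%E.
have mS : measurable_fun setT S.
  apply: ge0_emeasurable_sum => [t w _ _|t _]; first by rewrite lee_fin.
  exact/measurable_EFinP.
have S0 w : (0 <= S w)%E by apply: nneseries_ge0 => t _ _; rewrite lee_fin.
have iS : (\int[P]_w S w < +oo)%E.
  rewrite integral_nneseries//; last 2 first.
  - by move=> t; exact/measurable_EFinP.
  - by move=> t w _; rewrite lee_fin.
  apply: (@le_lt_trans _ _ c%:E); last exact: ltry.
  apply: lime_le.
    apply: is_cvg_nneseries => t _ _; apply: integral_ge0 => w _.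
    by rewrite lee_fin.
  by apply: nearW => N; rewrite big_mkord.
have : P.-integrable setT S.
  apply/integrableP; split => //.
  by under eq_integral do rewrite gee0_abs//.
move=> /integrable_ae -/(_ measurableT).
apply: filterS => w /(_ Logic.I) Sw.
apply: cvg_series_cvg_0; apply: nondecreasing_is_cvgn.
  by apply: nondecreasing_series => t _ _; exact: u0.
exists (fine (S w)) => _ [N _ <-].
rewrite -lee_fin fineK// /series/= -sumEFin.
by apply: nneseries_lim_ge => t _ _; rewrite lee_fin.
Qed.

End summable.

(** * Expected decrease of the Lyapunov function in one step *)

Section drift.
Context {R : realType} {d : nat} (nu : probability (Rd R d) R).
Variables (eta q K : R) (phi : R -> R).
Hypothesis phi0 : forall r, 0 <= r -> 0 <= phi r.
Hypothesis phi_homo : forall r s, r <= s -> phi r <= phi s.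
Hypothesis phi_drift : forall r b, 0 <= r -> r <= 1 -> 0 <= b -> b <= 1 - q ->
  b <= K * r -> (1 - b) * phi (contraction_rate eta * r) + b * phi 1 <= phi r - r.
Hypothesis success : forall x y : 'rV[R]_d, sphere d x -> sphere d y ->
  exists2 G : set (Rd R d), measurable G & [/\ forall xi, G xi ->
      misalign (hjmr_step eta x xi) (hjmr_step eta y xi) <=
      contraction_rate eta * misalign x y,
    fine (nu (~` G)) <= 1 - q & fine (nu (~` G)) <= K * misalign x y].

Lemma measurable_lyapunov_step {dS} {S : measurableType dS}
    (x y u : S -> 'rV[R]_d) :
  coord_measurable x -> coord_measurable y -> coord_measurable u ->
  measurable_fun setT (fun s => (phi (misalign (hjmr_step eta (x s) (u s))
    (hjmr_step eta (y s) (u s))))%:E).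
Proof.
move=> mx my mu; apply/measurable_EFinP.
apply: (measurableT_comp (nondecreasing_measurable measurableT phi_homo)).
by apply: measurable_misalign; exact: coord_measurable_hjmr_step.
Qed.

(** On [G] the integrand is at most the value of [phi] at the contracted misalignment, elsewhere at
    most [phi 1]; the two weights are those of [phi_drift]. *)
Lemma integral_lyapunov_step (x y : 'rV[R]_d) : sphere d x -> sphere d y ->
  (\int[nu]_xi (phi (misalign (hjmr_step eta x xi) (hjmr_step eta y xi)))%:E
   <= (phi (misalign x y) - misalign x y)%:E)%E.
Proof.
move=> Sx Sy; have [G mG [hG hq hK]] := success Sx Sy.
set f := fun xi : Rd R d => _; set r := misalign x y in hK hG *.
have f0 xi : (0 <= f xi)%E by rewrite lee_fin phi0// misalign_ge0.
have mf : measurable_fun setT f.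
  apply: measurable_lyapunov_step; try exact: coord_measurable_cst.
  by move=> j; exact: measurable_coord.
have mGC := measurableC mG.
rewrite -(setUv G) ge0_integral_setU//; last 3 first.
- by rewrite setUv.
- by move=> xi _; exact: f0.
- by apply/disj_set2P; rewrite setICr.
have hb := phi_drift (misalign_ge0 x y) (misalign_le1 x y)
  (fine_ge0 (measure_ge0 nu _)) hq hK.
have nuG : fine (nu G) = 1 - fine (nu (~` G)).
  by rewrite -[in LHS](setCK G) probability_setC// fineB ?fin_num_measure.
apply: (@le_trans _ _ ((1 - fine (nu (~` G))) * phi (contraction_rate eta * r) +
  fine (nu (~` G)) * phi 1)%:E); last by rewrite lee_fin.
rewrite EFinD; apply: leeD.
  rewrite -nuG mulrC EFinM fineK ?fin_num_measure// -integral_cst//.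
  apply: ge0_le_integral => //; [by move=> xi _; exact: f0|exact: measurable_funTS|].
  by move=> xi Gxi; rewrite lee_fin phi_homo// hG.
rewrite mulrC EFinM fineK ?fin_num_measure// -integral_cst//.
apply: ge0_le_integral => //; [by move=> xi _; exact: f0|exact: measurable_funTS|].
by move=> xi _; rewrite lee_fin phi_homo// misalign_le1.
Qed.

End drift.

(** * Convergence for one pair of agents *)

Section pair_convergence.
Context {R : realType} {n d : nat} {dT : measure_display} {T : measurableType dT}.
Variables (P : probability T R) (xi : nat -> T -> Rd R d) (eta q K : R).
Variable X0 : 'I_n -> 'rV[R]_d.
Hypotheses (eta0 : 0 < eta) (q0 : 0 < q) (K0 : 0 <= K).
Hypothesis mxi : forall t, measurable_fun setT (xi t).
Hypothesis xi_indep : mutually_independent P xi.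
Hypothesis sphere_X0 : forall i, sphere d (X0 i).
Hypothesis success : forall t (x y : 'rV[R]_d), sphere d x -> sphere d y ->
  exists2 G : set (Rd R d), measurable G & [/\ forall u, G u ->
      misalign (hjmr_step eta x u) (hjmr_step eta y u) <=
      contraction_rate eta * misalign x y,
    fine (P (xi t @^-1` (~` G))) <= 1 - q &
    fine (P (xi t @^-1` (~` G))) <= K * misalign x y].

Lemma ae_misalign_cvg0 (i j : 'I_n) : {ae P, forall w,
  (fun t => misalign (traj xi eta X0 t w i) (traj xi eta X0 t w j)) @ \oo
    --> (0 : R)}.
Proof.
have [phi [phi0 phi_homo phi_drift]] := exists_lyapunov
  (contraction_rate_gt0 eta) (contraction_rate_lt1 eta0) q0 K0.
pose r t w := misalign (traj xi eta X0 t w i) (traj xi eta X0 t w j).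
have r0 t w : 0 <= r t w by exact: misalign_ge0.
have r1 t w : r t w <= 1 by exact: misalign_le1.
have mrp t : measurable_fun [set: past xi t] (r t).
  by apply: measurable_misalign; exact: measurable_traj.
have mid t : measurable_fun setT (id : T -> past xi t) by exact: measurable_past.
have mr t : measurable_fun [set: T] (r t) by exact: measurableT_comp (mrp t) (mid t).
have mphi : measurable_fun setT phi by exact: nondecreasing_measurable.
have mphir t : measurable_fun [set: T] (fun w => phi (r t w)).
  exact: measurableT_comp mphi (mr t).
have mphirE t : measurable_fun [set: T] (fun w => (phi (r t w))%:E).
  by apply/measurable_EFinP.
have mrE t : measurable_fun [set: T] (fun w => (r t w)%:E).
  by apply/measurable_EFinP.
have mdr t : measurable_fun [set: T] (fun w => (phi (r t w) - r t w)%:E).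
  by apply/measurable_EFinP; exact: measurable_funB.
have St t w k : sphere d (traj xi eta X0 t w k) by exact: sphere_traj.
(* The left side of the drift inequality is nonnegative, so [phi r - r] can be integrated as a
   nonnegative function. *)
have rphi t w : r t w <= phi (r t w).
  have [G _ [_ hq hK]] := success t (St t w i) (St t w j).
  have b0 : 0 <= fine (P (xi t @^-1` (~` G))) by exact: fine_ge0.
  rewrite -subr_ge0; apply: le_trans (phi_drift _ _ (r0 t w) (r1 t w) b0 hq hK).
  have g0 := ltW (contraction_rate_gt0 eta).
  rewrite addr_ge0// mulr_ge0 ?phi0 ?mulr_ge0// subr_ge0.
  by apply: le_trans hq _; rewrite gerBl ltW.
have drift t : (\int[P]_w (phi (r t.+1 w))%:E <=
    \int[P]_w (phi (r t w) - r t w)%:E)%E.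
  (* The identity into the coarser space is the variable [Y] carrying the whole past; it is
     independent of [xi t]. *)
  pose Y : {mfun T >-> past xi t} := HB.pack (id : T -> past xi t)
    (isMeasurableFun.Build _ _ _ _ _ (mid t)).
  pose X : {mfun T >-> Rd R d} := HB.pack (xi t)
    (isMeasurableFun.Build _ _ _ _ _ (mxi t)).
  pose f (p : past xi t * Rd R d) := (phi (misalign
    (hjmr_step eta (traj xi eta X0 t p.1 i) p.2)
    (hjmr_step eta (traj xi eta X0 t p.1 j) p.2)))%:E.
  have mf : measurable_fun setT f.
    apply: measurable_lyapunov_step => //.
    - by move=> k; exact: measurableT_comp (measurable_traj eta X0 i (leqnn t) k) measurable_fst.
    - by move=> k; exact: measurableT_comp (measurable_traj eta X0 j (leqnn t) k) measurable_fst.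
    - exact: coord_measurableT.
  have f0 p : (0 <= f p)%E by rewrite lee_fin phi0// misalign_ge0.
  rewrite (_ : (\int[P]_w _)%E = (\int[P]_w f (Y w, X w))%E)//.
  rewrite (integral_independent _ mf f0); last first.
    by move=> A B mA mB; exact: past_independent.
  apply: ge0_le_integral => //.
  - by move=> w _; apply: integral_ge0.
  - have mF : measurable_fun setT
        (fun w : past xi t => \int[distribution P X]_u f (w, u))%E.
      exact: measurable_fun_fubini_tonelli_F.
    exact: (measurableT_comp mF (mid t)).
  move=> w _.
  have H := @integral_lyapunov_step _ _ (distribution P X) _ _ _ _ phi0 phi_homo
    phi_drift.
  have {}H := H (success t).
  have {}H := H _ _ (St t w i) (St t w j).
  exact: H.
(* Telescoping the drift bounds the sum of the expected misalignments by the initial expectation of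
   [phi]. *)
have sum_drift N : (\int[P]_w (phi (r N w))%:E + \sum_(t < N) \int[P]_w (r t w)%:E
    <= \int[P]_w (phi (r 0 w))%:E)%E.
  elim: N => [|N IH]; first by rewrite big_ord0 adde0.
  apply: le_trans IH; rewrite big_ord_recr/= addeA addeAC.
  rewrite leeD2r//; apply: (le_trans (leeD2r _ (drift N))).
  rewrite -ge0_integralD//; last 2 first.
  - by move=> w _; rewrite lee_fin subr_ge0.
  - by move=> w _; rewrite lee_fin.
  by rewrite le_eqVlt; apply/orP; left; apply/eqP/eq_integral => w _;
    rewrite -EFinD subrK.
apply: (@ae_cvg0_of_sum_integral _ _ _ P r (phi 1)) => // N.
apply: (@le_trans _ _ (\int[P]_w (phi (r 0 w))%:E)%E).
  apply: le_trans (sum_drift N); rewrite leeDr//.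
  by apply: integral_ge0 => w _; rewrite lee_fin phi0.
apply: (@le_trans _ _ (\int[P]_w cst (phi 1)%:E w)%E).
  apply: ge0_le_integral => //.
  - by move=> w _; rewrite lee_fin phi0.
  - by move=> w _; rewrite lee_fin phi_homo.
by rewrite integral_cst//= probability_setT mule1.
Qed.

End pair_convergence.

(** * From pairs of agents to the distance from the polarized set *)

Unset Implicit Arguments.
Theorem theorem3p2 (R : realType) (n d : nat) (eta : R)
  (dT : measure_display) (T : measurableType dT) (P : probability T R)
  (mu : probability (Rd R d) R) (xi : nat -> T -> Rd R d)
  (X0 : 'I_n -> 'rV[R]_d) :
  (1 <= n)%N -> (1 <= d)%N -> 0 < eta ->
  uniform_sphere_measure mu ->
  (forall t, measurable_fun setT (xi t)) ->
  mutually_independent P xi ->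
  (forall t (A : set (Rd R d)), measurable A ->
     P (xi t @^-1` A) = P (xi 0%N @^-1` A)) ->
  P (xi 0%N @^-1` (~` sphere d)) = 0%E ->
  (exists C C' : R, 0 < C /\ 0 < C' /\
     forall A : set (Rd R d), measurable A -> A `<=` sphere d ->
       (C%:E * mu A <= P (xi 0%N @^-1` A) <= C'%:E * mu A)%E) ->
  (forall i, sphere d (X0 i)) ->
  {ae P, forall w,
     (fun t => rho (hjmr_traj eta X0 (fun s => xi s w) t)) @ \oo --> (0 : R)}.
Proof.
move=> n_gt0 d_gt0 eta0 mu_unif mxi xi_indep xi_law xi_sphere [C [C' [C0 [C'0 xi_mu]]]] SX.
have success t (x y : 'rV[R]_d) : sphere d x -> sphere d y ->
    exists2 G : set (Rd R d), measurable G & [/\ forall u, G u ->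
      misalign (hjmr_step eta x u) (hjmr_step eta y u) <=
      contraction_rate eta * misalign x y,
    fine (P (xi t @^-1` (~` G))) <= 1 - C / 2 &
    fine (P (xi t @^-1` (~` G))) <= 2 * C' * misalign x y].
  pose X : {mfun T >-> Rd R d} := HB.pack (xi t)
    (isMeasurableFun.Build _ _ _ _ _ (mxi t)).
  apply: (@exists_success _ _ mu (distribution P X)) => //.
  - rewrite -xi_sphere; apply: xi_law; apply: measurableC.
    exact: measurable_sphere.
  - move=> A mA AS.
    by have := xi_mu A mA AS; rewrite -(xi_law t A mA).
have K0 : 0 <= 2 * C' by rewrite mulr_ge0// ltW.
have q0 : 0 < C / 2 by rewrite divr_gt0.
pose j := Ordinal n_gt0.
have : {ae P, forall w (i : 'I_n), (fun t => misalign (traj xi eta X0 t w j)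
    (traj xi eta X0 t w i)) @ \oo --> (0 : R)}.
  (* Finitely many agents: the almost sure events of the pairs [(j, i)] intersect in an almost sure
     event. *)
  apply: filter_forall => i.
  exact: ae_misalign_cvg0 eta0 q0 K0 mxi xi_indep SX success j i.
apply: filterS => w lim0.
pose u t := Num.sqrt (2 * \sum_(i < n) misalign (traj xi eta X0 t w j) (traj xi eta X0 t w i) ^+ 2).
apply: (@squeeze_cvgr _ _ _ _ (fun=> 0) u).
- by apply: nearW => t; rewrite rho_ge0 rho_le// => i; exact: sphere_traj.
- exact: cvg_cst.
rewrite -[X in _ --> X]sqrtr0; apply: continuous_cvg; first exact: sqrt_continuous.
have sq_cvg0 i : misalign (traj xi eta X0 t w j) (traj xi eta X0 t w i) ^+ 2
    @[t --> \oo] --> (0 : R).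
  by have := cvgM (lim0 i) (lim0 i); rewrite mulr0; exact.
have sum_cvg0 : \sum_(i < n) misalign (traj xi eta X0 t w j)
    (traj xi eta X0 t w i) ^+ 2 @[t --> \oo] --> \sum_(i < n) (0 : R).
  apply: (cvg_big (@add_continuous R)) => i _; exact: sq_cvg0.
rewrite big1// in sum_cvg0.
by have := cvgM (cvg_cst (2 : R)) sum_cvg0; rewrite mulr0; exact.
Qed.
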